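(* Let $A$ be an algebra of the variety $\mathcal{V}$ such that $K(A)$ is closed under the commutator operation. Then: (1) for any congruence $\phi\in Spec(A)$ we have $O(\phi^{\ast})=(\widetilde{O}(\phi))^{\ast}$; (2) for any prime ideal $P$ of $L(A)$ we have $(O(P))_{\ast}=\widetilde{O}(P_{\ast})$.
   Context: $\mathcal{V}$ is a fixed congruence-modular variety of algebras (of a finite signature) that is semidegenerate: no nontrivial algebra in $\mathcal{V}$ has one-element subalgebras (equivalently, $\nabla_A$ is compact in $Con(A)$ for every $A\in\mathcal{V}$). For $A\in\mathcal{V}$, $Con(A)$ is the complete lattice of congruences of $A$, with least element $\Delta_A$ and greatest element $\nabla_A$; $K(A)$ is the set of compact (= finitely generated) congruences. Commutator: $[\cdot,\cdot]=[\cdot,\cdot]_A$ is the (modular) commutator, i.e. the greatest operation on the congruence lattices of members of $\mathcal{V}$ such that for every surjective morphism $f:A\to B$ in $\mathcal{V}$ and all $\alpha,\beta\in Con(A)$: $[\alpha,\beta]_A\subseteq\alpha\cap\beta$ and $[\alpha,\beta]_A\vee Ker(f)=f^{-1}([f(\alpha\vee Ker(f)),f(\beta\vee Ker(f))]_B)$. Residuation: $\alpha\rightarrow\beta=\bigvee\{\gamma\in Con(A)\mid[\alpha,\gamma]\subseteq\beta\}$. $\phi\in Con(A)\setminus\{\nabla_A\}$ is prime if $[\alpha,\beta]\subseteq\phi$ implies $\alpha\subseteq\phi$ or $\beta\subseteq\phi$ (for $\alpha,\beta\in Con(A)$); $Spec(A)$ is the set of prime congruences; $\rho(\theta)=\bigcap\{\phi\in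 Spec(A)\mid\theta\subseteq\phi\}$. Reticulation: when $K(A)$ is closed under the commutator, $L(A)=K(A)/{\equiv}$ where $\alpha\equiv\beta$ iff $\rho(\alpha)=\rho(\beta)$; $\lambda_A:K(A)\to L(A)$ is the quotient map; $L(A)$ is a bounded distributive lattice with $\lambda_A(\alpha)\vee\lambda_A(\beta)=\lambda_A(\alpha\vee\beta)$, $\lambda_A(\alpha)\wedge\lambda_A(\beta)=\lambda_A([\alpha,\beta])$, $0=\lambda_A(\Delta_A)$, $1=\lambda_A(\nabla_A)$. For $\theta\in Con(A)$, $\theta^{\ast}=\{\lambda_A(\alpha)\mid\alpha\in K(A),\alpha\subseteq\theta\}$, an ideal of $L(A)$; for an ideal $I$ of $L(A)$, $I_{\ast}=\bigvee\{\alpha\in K(A)\mid\lambda_A(\alpha)\in I\}\in Con(A)$. If $\phi\in Spec(A)$ then $\phi^{\ast}$ is a prime ideal of $L(A)$, and if $P$ is a prime ideal of $L(A)$ then $P_{\ast}\in Spec(A)$. For $\phi\in Spec(A)$, $\widetilde{O}(\phi)=\bigvee\{\alpha\in K(A)\mid\alpha\subseteq\phi,\ \alpha\rightarrow\rho(\Delta_A)\not\subseteq\phi\}$. For a prime ideal $P$ of a bounded distributive lattice $L$, $O(P)=\{x\in L\mid Ann(x)\not\subseteq P\}$ (an ideal of $L$), where $Ann(x)=\{y\in L\mid x\wedge y=0\}$. *)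

(* Defs.v *)
From HB Require Import structures.
From mathcomp Require Import all_boot all_order.
From mathcomp Require Import generic_quotient.
From mathcomp Require Import boolp classical_sets functions cardinality.

Set Implicit Arguments.
Unset Strict Implicit.
Unset Printing Implicit Defensive.

Import Order.TTheory.
Local Open Scope classical_set_scope.
Local Open Scope order_scope.

Record signature := Signature { symb : finType; arity : symb -> nat }.

Record algebra (sg : signature) := Algebra {
  carrier :> Type;
  carrier_inh : inhabited carrier;
  interp : forall f : symb sg, ('I_(arity f) -> carrier) -> carrier }.
Arguments interp {sg a} f _.

Inductive term (sg : signature) :=
  | Var of nat
  | App (f : symb sg) of ('I_(arity f) -> term sg).

Fixpoint eval sg (A : algebra sg) (env : nat -> A) (t : term sg) : A :=
  match t with
  | Var n => env n
  | App f ts => interp f (fun i => eval env (ts i))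
  end.

(** A variety is presented as an equational class, by the set of its
    identities. *)
Definition variety (sg : signature) := set (term sg * term sg).

Definition satisfies sg (V : variety sg) (A : algebra sg) :=
  forall e, V e -> forall env : nat -> A, eval env e.1 = eval env e.2.

Record member sg (V : variety sg) := Member {
  member_alg :> algebra sg;
  memberP : satisfies V member_alg }.

Definition subalgebra sg (A : algebra sg) (S : set A) :=
  S !=set0 /\ forall f u, (forall i, S (u i)) -> S (interp f u).

Definition semidegenerate sg (V : variety sg) :=
  forall A : member V, (exists x y : A, x <> y) ->
    ~ exists a : A, subalgebra [set a].

Record congr sg (A : algebra sg) := Congr {
  crel :> A -> A -> Prop;
  congr_refl : forall x, crel x x;
  congr_sym : forall x y, crel x y -> crel y x;
  congr_trans : forall y x z, crel x y -> crel y z -> crel x z;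
  congr_interp : forall f (u v : 'I_(arity f) -> A),
    (forall i, crel (u i) (v i)) -> crel (interp f u) (interp f v) }.

Lemma congr_ext sg (A : algebra sg) (a b : congr A) :
  (forall x y, a x y <-> b x y) -> a = b.
Proof.
case: a b => [r r1 r2 r3 r4] [s s1 s2 s3 s4] /= rs.
have E : r = s by apply/funext => x; apply/funext => y; apply/propext.
by subst s; congr Congr; exact: Prop_irrelevance.
Qed.

HB.instance Definition _ sg (A : algebra sg) := gen_eqMixin (congr A).
HB.instance Definition _ sg (A : algebra sg) := gen_choiceMixin (congr A).

Definition cgen sg (A : algebra sg) (r : A -> A -> Prop) : congr A.
Proof.
exists (fun x y => forall c : congr A, (forall u v, r u v -> c u v) -> c x y).
- by move=> x c _; exact: congr_refl.
- by move=> x y xy c rc; apply: congr_sym; exact: xy.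
- by move=> y x z xy yz c rc; apply: (@congr_trans _ _ _ y); [exact: xy|exact: yz].
- by move=> f u v uv c rc; apply: congr_interp => i; exact: uv.
Defined.

Definition cmeet sg (A : algebra sg) (a b : congr A) : congr A.
Proof.
exists (fun x y => a x y /\ b x y).
- by move=> x; split; exact: congr_refl.
- by move=> x y [? ?]; split; exact: congr_sym.
- by move=> y x z [? ?] [? ?]; split; apply: (@congr_trans _ _ _ y).
- by move=> f u v uv; split; apply: congr_interp => i; have [] := uv i.
Defined.

Definition cdelta sg (A : algebra sg) : congr A.
Proof.
exists (fun x y => x = y) => //.
- by move=> y x z -> ->.
- by move=> f u v uv; congr interp; apply/funext.
Defined.

Definition cnabla sg (A : algebra sg) : congr A :=
  @Congr _ A (fun _ _ => True) (fun _ => I) (fun _ _ _ => I)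
    (fun _ _ _ _ _ => I) (fun _ _ _ _ => I).

Fact con_display : Order.disp_t. Proof. exact: Order.Disp tt tt. Qed.

Section CongruenceLattice.
Variables (sg : signature) (A : algebra sg).
Implicit Types a b c : congr A.

Definition cle a b := `[< forall x y, a x y -> b x y >].
Definition cjoin2 a b := cgen (fun x y => a x y \/ b x y).

Lemma cle_refl : reflexive cle.
Proof. by move=> a; apply/asboolP. Qed.

Lemma cle_anti : antisymmetric cle.
Proof.
move=> a b /andP[/asboolP ab /asboolP ba].
by apply: congr_ext => x y; split; [exact: ab|exact: ba].
Qed.

Lemma cle_trans : transitive cle.
Proof.
by move=> b a c /asboolP ab /asboolP bc; apply/asboolP => x y /ab /bc.
Qed.

HB.instance Definition _ :=
  Order.Le_isPOrder.Build con_display (congr A)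
    cle_refl cle_anti cle_trans.

Lemma cleP a b : reflect (forall x y, a x y -> b x y) (a <= b).
Proof. exact: asboolP. Qed.

Let leI c a b : (c <= cmeet a b) = (c <= a) && (c <= b).
Proof.
apply/cleP/andP => [h|[/cleP ca /cleP cb] x y cxy].
  by split; apply/cleP => x y /h[].
by split; [exact: ca|exact: cb].
Qed.

Let leU a b c : (cjoin2 a b <= c) = (a <= c) && (b <= c).
Proof.
apply/cleP/andP => [h|[/cleP ac /cleP bc] x y xy].
  by split; apply/cleP => x y xy; apply: h => d; apply; [left|right].
by apply: xy => u v [/ac|/bc].
Qed.

HB.instance Definition _ :=
  Order.POrder_isMeetSemilattice.Build con_display (congr A) leI.
HB.instance Definition _ :=
  Order.POrder_isJoinSemilattice.Build con_display (congr A) leU.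

Let cdelta_le a : cdelta A <= a.
Proof. by apply/cleP => x y ->; exact: congr_refl. Qed.

Let le_cnabla a : a <= cnabla A.
Proof. by apply/cleP. Qed.

HB.instance Definition _ :=
  Order.hasBottom.Build con_display (congr A) cdelta_le.
HB.instance Definition _ :=
  Order.hasTop.Build con_display (congr A) le_cnabla.

Definition cjoin (S : set (congr A)) : congr A :=
  cgen (fun x y => exists2 a, S a & a x y).

Definition cinf (S : set (congr A)) : congr A :=
  cjoin [set c | forall a, S a -> c <= a].

Lemma cjoin_ub (S : set (congr A)) a : S a -> a <= cjoin S.
Proof. by move=> Sa; apply/cleP => x y axy c; apply; exists a. Qed.

Lemma cjoin_lub (S : set (congr A)) c :
  (forall a, S a -> a <= c) -> cjoin S <= c.
Proof.
by move=> h; apply/cleP => x y; apply => u v [a /h /cleP ac] /ac.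
Qed.

Lemma cinfP (S : set (congr A)) x y :
  cinf S x y <-> forall a, S a -> a x y.
Proof.
split=> [h a Sa|h].
  by apply: h => u v [c /(_ _ Sa) /cleP ca] /ca.
pose r u v := forall a, S a -> a u v.
have r1 u : r u u by move=> a _; exact: congr_refl.
have r2 u v : r u v -> r v u by move=> uv a Sa; apply: congr_sym; exact: uv.
have r3 v u w : r u v -> r v w -> r u w.
  by move=> uv vw a Sa; apply: (@congr_trans _ _ _ v); [exact: uv|exact: vw].
have r4 f (u v : 'I_(arity f) -> A) :
    (forall i, r (u i) (v i)) -> r (interp f u) (interp f v).
  by move=> uv a Sa; apply: congr_interp => i; exact: uv.
have /cjoin_ub/cleP : [set c | forall a, S a -> c <= a] (Congr r1 r2 r3 r4).
  by move=> a Sa; apply/cleP => u v; exact.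
exact.
Qed.

Definition compact a :=
  forall S : set (congr A), a <= cjoin S ->
    exists F, [/\ finite_set F, F `<=` S & a <= cjoin F].

End CongruenceLattice.

Definition modular_lattice d (L : latticeType d) :=
  forall x y z : L, x <= z -> x `|` (y `&` z) = (x `|` y) `&` z.

Definition congruence_modular sg (V : variety sg) :=
  forall A : member V, modular_lattice (congr A).

Record hom sg (A B : algebra sg) := Hom {
  hom_fun :> A -> B;
  hom_interp : forall f u, hom_fun (interp f u) = interp f (hom_fun \o u) }.

Definition surjective sg (A B : algebra sg) (f : hom A B) :=
  forall y, exists x, f x = y.

Definition cpreim sg (A B : algebra sg) (f : hom A B) (b : congr B) : congr A.
Proof.
exists (fun x y => b (f x) (f y)).
- by move=> x; exact: congr_refl.
- by move=> x y; exact: congr_sym.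
- by move=> y x z; exact: congr_trans.
- by move=> g u v uv; rewrite !hom_interp; exact: congr_interp.
Defined.

Lemma cpreim_le sg (A B : algebra sg) (f : hom A B) (b c : congr B) :
  b <= c -> cpreim f b <= cpreim f c.
Proof. by move=> /cleP bc; apply/cleP => x y /bc. Qed.

Definition cker sg (A B : algebra sg) (f : hom A B) : congr A := cpreim f \bot.

(** The image of a congruence; [cgen] only makes it total, see [cimageE]. *)
Definition cimage sg (A B : algebra sg) (f : hom A B) (a : congr A) : congr B :=
  cgen (fun u v => exists x y, [/\ f x = u, f y = v & a x y]).

Lemma cimageE sg (A B : algebra sg) (f : hom A B) (a : congr A) :
  surjective f -> cker f <= a ->
  forall u v, cimage f a u v <-> exists x y, [/\ f x = u, f y = v & a x y].
Proof.
move=> /choice[g gK] /cleP ka u v.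
have fa x y : f x = f y -> a x y by exact: ka.
have ag x x' : f x = f x' -> a (g (f x)) x' by move=> xx'; apply: fa; rewrite gK.
split=> [|h c]; last by apply.
pose r (u v : B) := a (g u) (g v).
have r1 u' : r u' u' by exact: congr_refl.
have r2 u' v' : r u' v' -> r v' u' by exact: congr_sym.
have r3 v' u' w' : r u' v' -> r v' w' -> r u' w' by exact: congr_trans.
have r4 h (s t : 'I_(arity h) -> B) :
    (forall i, r (s i) (t i)) -> r (interp h s) (interp h t).
  move=> st; have E (w : 'I_(arity h) -> B) :
      f (g (interp h w)) = f (interp h (g \o w)).
    by rewrite gK hom_interp; congr interp; apply/funext => i /=; rewrite gK.
  apply: congr_trans (fa _ _ (E s)) _.
  apply: congr_trans _ (congr_sym (fa _ _ (E t))).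
  exact: congr_interp.
move=> /(_ (Congr r1 r2 r3 r4)) /=; rewrite /r => H.
exists (g u), (g v); split=> //; apply: H => _ _ [x [y [<- <- xy]]].
apply: congr_trans (ag x x erefl) _.
exact: congr_trans xy (congr_sym (ag y y erefl)).
Qed.

Definition con_op sg (V : variety sg) :=
  forall A : member V, congr A -> congr A -> congr A.

Definition commutator_like sg (V : variety sg) (C : con_op V) :=
  forall (A B : member V) (f : hom A B), surjective f ->
  forall a b : congr A,
    C A a b <= a `&` b /\
    C A a b `|` cker f =
      cpreim f (C B (cimage f (a `|` cker f)) (cimage f (b `|` cker f))).

(** The modular commutator is the greatest [commutator_like] operation. The
    pointwise join of all of them is one, see [commutator_like_commutator]. *)
Definition commutator sg (V : variety sg) : con_op V :=
  fun A a b => cjoin (fun c => exists C, commutator_like C /\ c = C A a b).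

Lemma commutator_greatest sg (V : variety sg) (C : con_op V) :
  commutator_like C -> forall A a b, C A a b <= @commutator _ V A a b.
Proof. by move=> hC A a b; apply: cjoin_ub; exists C. Qed.

Lemma commutator_like_commutator sg (V : variety sg) :
  commutator_like (@commutator _ V).
Proof.
move=> A B f fsurj a b; split.
  by apply: cjoin_lub => _ [C [hC ->]]; have [] := hC _ _ _ fsurj a b.
apply/le_anti/andP; split.
  rewrite leUx; apply/andP; split; last first.
    apply/cleP => x y kxy; have E : f x = f y by [].
    by rewrite /= E; exact: (congr_refl (commutator _ _)).
  apply: cjoin_lub => _ [C [hC ->]].
  apply: le_trans (leUl _ (cker f)) _; rewrite (hC _ _ _ fsurj a b).2.
  exact/cpreim_le/commutator_greatest.
set t := commutator a b `|` cker f.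
have kt : cker f <= t by exact: leUr.
have tE := cimageE fsurj kt.
suff : commutator (cimage f (a `|` cker f)) (cimage f (b `|` cker f))
         <= cimage f t.
  move=> /cleP h; apply/cleP => x y /h /tE[x' [y' [xx' yy' x'y']]].
  have kP u v : f u = f v -> t u v by move/cleP: kt => /(_ u v).
  have xx : t x x' := kP _ _ (esym xx').
  exact (congr_trans xx (congr_trans x'y' (kP _ _ yy'))).
apply: cjoin_lub => _ [C [hC ->]]; apply/cleP => u v.
have [x <-] := fsurj u; have [y <-] := fsurj v => xy.
apply/tE; exists x, y; split=> //.
have /cleP : C A a b `|` cker f <= t by apply: leU2 => //; exact: commutator_greatest.
by apply; rewrite (hC _ _ _ fsurj a b).2.
Qed.

Lemma commutator_leI sg (V : variety sg) (A : member V) (a b : congr A) :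
  commutator a b <= a `&` b.
Proof.
have idP f u : (id : A -> A) (interp f u) = interp f (id \o u) by [].
have idS : surjective (Hom idP) by move=> x; exists x.
exact: (commutator_like_commutator idS a b).1.
Qed.

Section Commutator.
Variables (sg : signature) (V : variety sg) (A : member V).
Implicit Types a b c : congr A.

Definition residual a b := cjoin [set c | commutator a c <= b].

Definition prime_congr (p : congr A) :=
  p <> \top /\
  forall a b, commutator a b <= p -> a <= p \/ b <= p.

Definition rho a := cinf [set p | prime_congr p /\ a <= p].

Definition commutator_closed :=
  forall a b, compact a -> compact b -> compact (commutator a b).

Lemma prime_commutator p a b :
  prime_congr p -> (commutator a b <= p) = (a <= p) || (b <= p).
Proof.
move=> [_ pp]; apply/idP/orP; first exact: pp.
have := commutator_leI a b; rewrite lexI => /andP[la lb].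
by case; apply: le_trans.
Qed.

Lemma rho_eqP a b :
  rho a = rho b <-> forall p, prime_congr p -> (a <= p) = (b <= p).
Proof.
have le_rho c : c <= rho c.
  by apply/cleP => x y cxy; apply/cinfP => p [_ /cleP]; exact.
have rho_le c p : prime_congr p -> c <= p -> rho c <= p.
  by move=> hp cp; apply/cleP => x y /cinfP; apply.
split=> [ab p hp|h].
  apply/idP/idP => cp.
    by apply: le_trans (le_rho b) _; rewrite -ab; exact: rho_le.
  by apply: le_trans (le_rho a) _; rewrite ab; exact: rho_le.
congr cinf; apply/seteqP; split=> p [hp ap]; split=> //.
  by rewrite -h.
by rewrite h.
Qed.

Definition Otilde (p : congr A) :=
  cjoin [set a | [/\ compact a, a <= p & ~ residual a (rho \bot) <= p]].

End Commutator.

Section Compact.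
Variables (sg : signature) (A : algebra sg).
Implicit Types a b c : congr A.

Lemma compact_bot : compact (\bot : congr A).
Proof. by move=> S _; exists set0; split=> //; exact: le0x. Qed.

Lemma compactU a b : compact a -> compact b -> compact (a `|` b).
Proof.
move=> ca cb S; rewrite leUx => /andP[/ca[F [Ff FS aF]] /cb[G [Gf GS bG]]].
exists (F `|` G); split; first by rewrite finite_setU.
  by move=> x [/FS|/GS].
have m (H H' : set (congr A)) : H `<=` H' -> cjoin H <= cjoin H'.
  by move=> HH'; apply: cjoin_lub => c /HH'; exact: cjoin_ub.
rewrite leUx (le_trans aF) ?(le_trans bG)//; apply: m; by [left|right].
Qed.

Lemma compact_cgen (I : finType) (s : I -> A * A) :
  compact (cgen (fun x y => exists i, s i = (x, y))).
Proof.
move=> S sS.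
have m (H H' : set (congr A)) x y : H `<=` H' -> cjoin H x y -> cjoin H' x y.
  move=> HH'; apply/cleP; apply: cjoin_lub => c /HH'; exact: cjoin_ub.
pose r x y := exists F, [/\ finite_set F, F `<=` S & cjoin F x y].
have rI (J : finType) (u v : J -> A) : (forall i, r (u i) (v i)) ->
    exists F, [/\ finite_set F, F `<=` S & forall i, cjoin F (u i) (v i)].
  move=> /choice[F FP]; exists (\bigcup_(i in setT) F i); split.
  - by apply: bigcup_finite => [|i _]; [exact: finite_finset|have [] := FP i].
  - by apply: bigcup_sub => i _; have [] := FP i.
  - move=> i; have [_ _] := FP i; apply: m.
    exact: (bigcup_sup (P := setT)).
have r1 x : r x x by exists set0; split=> //; exact: congr_refl.
have r2 x y : r x y -> r y x.
  by move=> [F [? ? ?]]; exists F; split=> //; exact: congr_sym.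
have r3 y x z : r x y -> r y z -> r x z.
  move=> [F [Ff FS xy]] [G [Gf GS yz]]; exists (F `|` G); split.
  - by rewrite finite_setU.
  - by move=> c [/FS|/GS].
  - apply: (@congr_trans _ _ _ y); first by apply: m xy; left.
    by apply: m yz; right.
have r4 f (u v : 'I_(arity f) -> A) :
    (forall i, r (u i) (v i)) -> r (interp f u) (interp f v).
  move=> /rI[F [Ff FS uv]]; exists F; split=> //; exact: congr_interp.
have Sr : cjoin S <= Congr r1 r2 r3 r4.
  apply: cjoin_lub => a Sa; apply/cleP => x y axy /=.
  exists [set a]; split=> //; first by move=> _ ->.
  by move: x y axy; apply/cleP; exact: cjoin_ub.
have /rI[F [Ff FS sF]] : forall i, r (s i).1 (s i).2.
  move=> i; move/cleP: (le_trans sS Sr); apply=> c; apply.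
  by exists i; case: (s i).
exists F; split=> //; apply/cleP => x y; apply => u v [i] si.
by have := sF i; rewrite si.
Qed.

End Compact.

(** Elements of the quotient algebra are equivalence classes. *)
Section Quotient.
Variables (sg : signature) (V : variety sg) (A : member V) (c : congr A).

Definition qcarrier := {P : set A | exists x, P = c x}.

Definition qpi (x : A) : qcarrier := exist _ (c x : set A) (ex_intro _ x erefl).

Lemma qpiE x y : qpi x = qpi y <-> c x y.
Proof.
split=> [[->]|xy]; first exact: congr_refl.
apply: eq_exist; apply/funext => z; apply/propext; split=> h.
  exact: congr_trans (congr_sym xy) h.
exact: congr_trans xy h.
Qed.

Definition qrepr (u : qcarrier) : A := projT1 (cid (svalP u)).

Lemma qreprK u : qpi (qrepr u) = u.
Proof.
by case: u => P eP; apply: eq_exist; rewrite /qrepr; case: cid => x /= ->.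
Qed.

Lemma q_inh : inhabited qcarrier.
Proof. by have [x] := carrier_inh A; exact: inhabits (qpi x). Qed.

Definition qalg := @Algebra sg qcarrier q_inh
  (fun f u => qpi (interp f (qrepr \o u))).

Lemma qpi_interp f (u : 'I_(arity f) -> A) :
  qpi (interp f u) = interp (a := qalg) f (qpi \o u).
Proof.
by apply/qpiE/congr_interp => i; apply/qpiE; rewrite /= qreprK.
Qed.

Definition qhom : hom A qalg := @Hom _ A qalg qpi qpi_interp.

Lemma qpi_eval env t : qpi (eval env t) = eval (A := qalg) (qpi \o env) t.
Proof.
elim: t => [//|f ts IH].
have E : qpi \o (fun i => eval env (ts i)) =
    (fun i => eval (A := qalg) (qpi \o env) (ts i)) by exact/funext.
by rewrite [LHS]qpi_interp E.
Qed.

Lemma qalg_sat : satisfies V qalg.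
Proof.
move=> e Ve env; have E : env = qpi \o (qrepr \o env).
  by apply/funext => n; rewrite /= qreprK.
by rewrite E -!qpi_eval (memberP Ve).
Qed.

Definition qmember : member V := Member qalg_sat.

End Quotient.

(** As the signature is finite, so is the set of pairs
    [(a, interp f (fun => a))]; modulo these, [a] is a subalgebra. *)
Lemma compact_top sg (V : variety sg) (A : member V) :
  semidegenerate V -> compact (\top : congr A).
Proof.
move=> sdV; have [a] := carrier_inh A.
have := @compact_cgen _ A _ (fun f : symb sg => (a, interp f (fun=> a))).
set c := cgen _; suff -> : c = \top by [].
have ca f : c a (interp f (fun=> a)) by move=> d; apply; exists f.
apply: congr_ext => x y; split=> // _; apply: contrapT => ncxy.
apply: (sdV (qmember c)).
  by exists (qpi c x), (qpi c y) => /qpiE.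
exists (qpi c a); split; first by exists (qpi c a).
move=> f u ua; have -> : u = qpi c \o (fun=> a) by apply/funext => i; exact: ua.
by apply: etrans (esym (qpi_interp c (fun=> a))) _; apply/qpiE/congr_sym.
Qed.

Section Ideals.
Variables (d : Order.disp_t) (L : tbDistrLatticeType d).
Implicit Types (I P : set L) (x y : L).

Definition lattice_ideal I :=
  [/\ I \bot, forall x y, I x -> I y -> I (x `|` y)
    & forall x y, y <= x -> I x -> I y].

Definition prime_ideal P :=
  [/\ lattice_ideal P, P <> setT & forall x y, P (x `&` y) -> P x \/ P y].

Definition ann x : set L := [set y | x `&` y = \bot].

Definition Oideal P : set L := [set x | ~ ann x `<=` P].

End Ideals.

Definition kcongr sg (A : algebra sg) := {a : congr A | `[< compact a >]}.

Definition kcon sg (A : algebra sg) (a : congr A) (ca : compact a) : kcongr A :=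
  exist _ a (asboolT ca).

Fact reticulation_display : Order.disp_t.
Proof. exact: Order.Disp tt tt. Qed.

Section Reticulation.
Variables (sg : signature) (V : variety sg) (A : member V).

Definition kequiv (a b : kcongr A) := rho (val a) == rho (val b).

Lemma kequiv_refl : reflexive kequiv.
Proof. by move=> a; rewrite /kequiv. Qed.

Lemma kequiv_sym : symmetric kequiv.
Proof. by move=> a b; rewrite /kequiv eq_sym. Qed.

Lemma kequiv_trans : transitive kequiv.
Proof. by move=> b a c /eqP ab; rewrite /kequiv ab. Qed.

Canonical kequiv_rel := EquivRel kequiv kequiv_refl kequiv_sym kequiv_trans.

(** The carrier [K(A)/rho]. The two hypotheses are what makes it a bounded
    lattice; they are parameters so that this structure can be inferred. *)
Definition reticulation of semidegenerate V & commutator_closed A :=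
  {eq_quot kequiv_rel}%qT.

Hypotheses (sdV : semidegenerate V) (cA : commutator_closed A).
Local Notation L := (reticulation sdV cA).

HB.instance Definition _ := Choice.on L.

Definition lambda (a : kcongr A) : L := \pi_({eq_quot kequiv_rel})%qT a.

Definition lrepr (x : L) : kcongr A := repr (x : {eq_quot kequiv_rel}%qT).

Lemma lambda_eqP a b : lambda a = lambda b <-> rho (val a) = rho (val b).
Proof. by split=> [/eqquotP/eqP//|ab]; apply/eqquotP/eqP. Qed.

Lemma lreprK x : lambda (lrepr x) = x.
Proof. exact: reprK. Qed.

Definition kcommutator (a b : kcongr A) : kcongr A :=
  kcon (cA (asboolW (valP a)) (asboolW (valP b))).

Definition kjoin (a b : kcongr A) : kcongr A :=
  kcon (compactU (asboolW (valP a)) (asboolW (valP b))).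

Definition lmeet (x y : L) := lambda (kcommutator (lrepr x) (lrepr y)).
Definition ljoin (x y : L) := lambda (kjoin (lrepr x) (lrepr y)).

(* A class is determined by the primes above its elements. *)
Let above (x : L) (p : congr A) := val (lrepr x) <= p.

Let above_lambda a p : prime_congr p -> above (lambda a) p = (val a <= p).
Proof. by move: p; apply/rho_eqP/lambda_eqP; exact: lreprK. Qed.

Let above_inj x y : (forall p, prime_congr p -> above x p = above y p) -> x = y.
Proof.
by move=> h; rewrite -(lreprK x) -(lreprK y); apply/lambda_eqP/rho_eqP.
Qed.

Let above_meet x y p : prime_congr p ->
  above (lmeet x y) p = above x p || above y p.
Proof. by move=> hp; rewrite above_lambda//= prime_commutator. Qed.

Let above_join x y p : prime_congr p ->
  above (ljoin x y) p = above x p && above y p.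
Proof. by move=> hp; rewrite above_lambda//= leUx. Qed.

Let aboveE := (above_meet, above_join).

Let lmeetC : commutative lmeet.
Proof. by move=> x y; apply: above_inj => p hp; rewrite !aboveE// orbC. Qed.

Let ljoinC : commutative ljoin.
Proof. by move=> x y; apply: above_inj => p hp; rewrite !aboveE// andbC. Qed.

Let lmeetA : associative lmeet.
Proof. by move=> x y z; apply: above_inj => p hp; rewrite !aboveE// orbA. Qed.

Let ljoinA : associative ljoin.
Proof. by move=> x y z; apply: above_inj => p hp; rewrite !aboveE// andbA. Qed.

Let ljoinKI y x : lmeet x (ljoin x y) = x.
Proof. by apply: above_inj => p hp; rewrite !aboveE//; case: (above x p). Qed.

Let lmeetKU y x : ljoin x (lmeet x y) = x.
Proof. by apply: above_inj => p hp; rewrite !aboveE//; case: (above x p). Qed.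

Let lmeetUl : left_distributive lmeet ljoin.
Proof. by move=> x y z; apply: above_inj => p hp; rewrite !aboveE// orb_andl. Qed.

Let lmeetxx : idempotent_op lmeet.
Proof. by move=> x; apply: above_inj => p hp; rewrite !aboveE// orbb. Qed.

HB.instance Definition _ :=
  @Order.isMeetJoinDistrLattice.Build reticulation_display L
    (fun x y => lmeet x y == x) (fun x y => (y != x) && (lmeet x y == x))
    lmeet ljoin (fun _ _ => erefl) (fun _ _ => erefl)
    lmeetC ljoinC lmeetA ljoinA ljoinKI lmeetKU lmeetUl lmeetxx.

Let lbot : L := lambda (kcon (@compact_bot _ A)).
Let ltop : L := lambda (kcon (compact_top sdV)).

Let lbot_le x : lbot <= x.
Proof.
apply/eqP; apply: above_inj => p hp.
by rewrite [LHS]above_meet// above_lambda//= le0x.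
Qed.

Let le_ltop x : x <= ltop.
Proof.
apply/eqP; apply: above_inj => p hp.
rewrite [LHS]above_meet// above_lambda//= orbC.
by have /negbTE -> : ~~ (\top <= p) by apply/negP; rewrite le1x => /eqP; apply hp.
Qed.

HB.instance Definition _ :=
  Order.hasBottom.Build reticulation_display L lbot_le.
HB.instance Definition _ :=
  Order.hasTop.Build reticulation_display L le_ltop.

Lemma lambdaI a b : lambda a `&` lambda b = lambda (kcommutator a b).
Proof.
by apply: above_inj => p hp; rewrite [LHS]above_meet// !above_lambda//= prime_commutator.
Qed.

Lemma lambdaU a b : lambda a `|` lambda b = lambda (kjoin a b).
Proof.
by apply: above_inj => p hp; rewrite [LHS]above_join// !above_lambda//= leUx.
Qed.

Lemma lambda0 : \bot = lambda (kcon (@compact_bot _ A)).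
Proof. by []. Qed.

Lemma lambda1 : \top = lambda (kcon (compact_top sdV)).
Proof. by []. Qed.

(** [con_star c] is the ideal written c^* and [ideal_star I] the congruence
    written I_*. *)
Definition con_star (c : congr A) : set L :=
  [set lambda a | a in [set a | val a <= c]].

Definition ideal_star (I : set L) : congr A :=
  cjoin [set val a | a in [set a | I (lambda a)]].

End Reticulation.
Arguments con_star {sg V A} sdV cA c _.
Arguments ideal_star {sg V A sdV cA} I.

(* Main.v *)
Require Import Defs.
From mathcomp Require Import all_boot all_order.
From mathcomp Require Import boolp classical_sets cardinality.

Set Implicit Arguments.
Unset Strict Implicit.
Unset Printing Implicit Defensive.

Import Order.TTheory.
Local Open Scope classical_set_scope.
Local Open Scope order_scope.

(** Both [O(P)] and [Otilde phi] describe the elements that are annihilated by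
    something outside a prime, and the reticulation translates one description
    into the other: [lambda a `&` lambda b = \bot] says that the commutator of
    [a] and [b] lies in [rho \bot], that is, that every prime congruence
    contains [a] or [b] ([lambdaI_eq0]).

    For (2), compactness of [a] gives [a <= P_*] exactly when [lambda a] is in
    [P] ([le_ideal_star]). The residual [a -> rho \bot] is a join of arbitrary
    congruences annihilating [a], but if it is not below [c], then some
    principal congruence below one of the joinands already witnesses this
    ([residual_rhoP]). Hence the two congruences in (2) are joins of the same
    set of compact congruences; the condition [a <= P_*] in the definition of
    [Otilde] comes from primality of [P], applied to
    [lambda a `&` lambda b = \bot] with [lambda b] outside [P].

    Then (1) is (2) for the prime ideal [P = phi^*], read through the
    correspondences [(phi^* )_* = phi] and [(I_* )^* = I], the latter applied to
    the ideal [O(phi^* )]. *)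

Section LatticeIdeals.
Variables (d : Order.disp_t) (L : tbDistrLatticeType d).
Implicit Types (P : set L) (x : L).

Lemma OidealP P x :
  Oideal P x <-> exists2 y, x `&` y = \bot & ~ P y.
Proof.
split=> [/existsNP[y /not_implyP[]]|[y xy nPy] /(_ _ xy)//].
by exists y.
Qed.

(** If [y] and [z] outside [P] annihilate two elements, then [y `&` z]
    annihilates their join, and it is outside [P] by primality. *)
Lemma Oideal_ideal P : prime_ideal P -> lattice_ideal (Oideal P).
Proof.
move=> [[P0 PU Ple] PnT Pp]; split.
- apply/OidealP; exists \top; first exact: meet0x.
  by move=> P1; apply/PnT/seteqP; split=> // x _; apply: Ple (lex1 x) P1.
- move=> x y /OidealP[x' xx' nx'] /OidealP[y' yy' ny']; apply/OidealP.
  exists (x' `&` y'); last by move=> /Pp[].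
  by rewrite meetUl meetA xx' meet0x join0x (meetC x') meetA yy' meet0x.
- move=> x y yx /OidealP[z xz nz]; apply/OidealP; exists z => //.
  by apply/le_anti; rewrite le0x andbT -xz leI2.
Qed.

End LatticeIdeals.

Section Congruences.
Variables (sg : signature) (A : algebra sg).
Implicit Types c e : congr A.

(** Every congruence is the join of the principal ones below it, and these are
    compact. *)
Lemma compact_separation c e :
  ~ c <= e -> exists2 k : kcongr A, val k <= c & ~ val k <= e.
Proof.
move=> nce; have : ~ forall x y, c x y -> e x y by move=> /cleP.
move=> /existsNP[x /existsNP[y /not_implyP[cxy nexy]]].
have := @compact_cgen _ A unit (fun=> (x, y)).
set k := cgen _ => ck; exists (kcon ck) => /=.
  by apply/cleP => u v; apply => _ _ [_ [<- <-]].
by move=> /cleP ke; apply: nexy; apply: ke => f; apply; exists tt.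
Qed.

End Congruences.

Section Reticulation.
Variables (sg : signature) (V : variety sg).
Hypothesis sdV : semidegenerate V.
Variable A : member V.
Hypothesis cA : commutator_closed A.
Implicit Types (a b : kcongr A) (c phi : congr A).

Local Notation L := (reticulation sdV cA).
Local Notation lam := (lambda sdV cA).

Implicit Types I P : set L.

Lemma le_rho_bot c :
  c <= rho \bot <-> forall p : congr A, prime_congr p -> c <= p.
Proof.
split=> [/cleP h p hp|h].
  apply/cleP => x y /h/cinfP; apply; split=> //; exact: le0x.
by apply/cleP => x y cxy; apply/cinfP => p [/h /cleP + _]; apply.
Qed.

Lemma commutator_le_rho_bot c1 c2 : commutator c1 c2 <= rho \bot <->
  forall p : congr A, prime_congr p -> (c1 <= p) || (c2 <= p).
Proof.
split=> [/le_rho_bot h p hp|h].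
  by rewrite -prime_commutator//; exact: h.
by apply/le_rho_bot => p hp; rewrite prime_commutator//; exact: h.
Qed.

Lemma lambdaI_eq0 a b : lam a `&` lam b = \bot <->
  commutator (val a) (val b) <= rho \bot.
Proof.
rewrite lambdaI lambda0; split=> [/lambda_eqP/rho_eqP h|/le_rho_bot h].
  by apply/le_rho_bot => p hp; rewrite h//=; exact: le0x.
by apply/lambda_eqP/rho_eqP => p hp; rewrite h//=; exact/esym/le0x.
Qed.

Lemma lambda_le a b : val a <= val b -> lam a <= lam b.
Proof.
move=> ab; suff -> : lam b = lam a `|` lam b by exact: leUl.
by rewrite lambdaU; congr (lam _); apply/val_inj/esym/join_r.
Qed.

(** A joinand of the residual that is not below [c] need not be compact, but
    replacing it by a smaller congruence keeps it annihilating [a]: every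
    prime still contains one of the two. *)
Lemma residual_rhoP a c : ~ residual (val a) (rho \bot) <= c <->
  exists2 b, lam a `&` lam b = \bot & ~ val b <= c.
Proof.
split=> [nle|[b /lambdaI_eq0 ab nbc] le]; last first.
  by apply: nbc; apply: le_trans le; exact: cjoin_ub.
have [g ag ngc] : exists2 g, commutator (val a) g <= rho \bot & ~ g <= c.
  apply: contra_notP nle => h; apply: cjoin_lub => g ag.
  by apply: contra_notP h => ngc; exists g.
have [b bg nbc] := compact_separation ngc; exists b => //.
apply/lambdaI_eq0/commutator_le_rho_bot => p hp.
have /orP[->//|gp] := (commutator_le_rho_bot _ _).1 ag p hp.
by rewrite (le_trans bg gp) orbT.
Qed.

(** The compact congruences sent into an ideal are closed under finite joins,
    so a compact congruence below their join is below one of them. *)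
Lemma le_ideal_star I a : lattice_ideal I ->
  (val a <= ideal_star I) <-> I (lam a).
Proof.
move=> [I0 IU Ile]; split=> [|Ia]; last by apply: cjoin_ub; exists a.
move=> /(asboolW (valP a)) [F [/finite_seqP[s ->{F}] sI ale]].
suff [k Ik sk] : exists2 k, I (lam k) & cjoin [set` s] <= val k.
  by apply: Ile Ik; apply: lambda_le; exact: le_trans ale sk.
elim: s sI {ale} => [|e s IH] sI.
  by exists (kcon (@compact_bot _ A)) => //; exact: cjoin_lub.
have [k Ik sk] : exists2 k, I (lam k) & cjoin [set` s] <= val k.
  by apply: IH => x /= xs; apply: sI; rewrite /= inE xs orbT.
have [b Ib be] := sI e (mem_head e s).
exists (kjoin b k); first by rewrite -lambdaU; exact: IU.
apply: cjoin_lub => x /=; rewrite inE => /orP[/eqP->|xs].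
  by rewrite -be; exact: leUl.
by apply: le_trans (leUr _ _); apply: le_trans sk; exact: cjoin_ub.
Qed.

Lemma ideal_starK I : lattice_ideal I -> con_star sdV cA (ideal_star I) = I.
Proof.
move=> hI; apply/seteqP; split=> [_ [a /(le_ideal_star _ hI) Ia <-]//|x].
by rewrite -(lreprK x) => Ix; exists (lrepr x) => //; exact/le_ideal_star.
Qed.

(** Congruences with the same image in [L] lie below the same primes. *)
Lemma con_star_lambda phi a : prime_congr phi ->
  con_star sdV cA phi (lam a) <-> val a <= phi.
Proof.
move=> hphi; split=> [[b /= bphi /lambda_eqP/rho_eqP ba]|]; last by exists a.
by rewrite -ba.
Qed.

Lemma con_starK phi : prime_congr phi ->
  ideal_star (con_star sdV cA phi) = phi.
Proof.
move=> hphi; apply/le_anti/andP; split.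
  by apply: cjoin_lub => _ [a /= /(con_star_lambda _ hphi) ? <-].
apply: contrapT => /compact_separation[k kphi]; apply; apply: cjoin_ub.
by exists k => //; exact/con_star_lambda.
Qed.

Lemma con_star_prime phi : prime_congr phi ->
  prime_ideal (con_star sdV cA phi).
Proof.
move=> hphi; have sE a := con_star_lambda a hphi; split; first split.
- by rewrite lambda0; apply/sE; exact: le0x.
- move=> x y; rewrite -(lreprK x) -(lreprK y) lambdaU => /sE xp /sE yp.
  by apply/sE; rewrite /= leUx xp.
- move=> x y yx; rewrite -(lreprK x) -(lreprK y) => /sE xp; apply/sE.
  have : lam (kcommutator cA (lrepr y) (lrepr x)) = lam (lrepr y).
    by rewrite -lambdaI !lreprK; exact/meet_idPl.
  by move=> /lambda_eqP/rho_eqP/(_ _ hphi) <-; rewrite /= prime_commutator// xp orbT.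
- move=> starT; apply: hphi.1; apply/eqP; rewrite -le1x.
  by apply/(sE (kcon (compact_top sdV))); rewrite starT.
- move=> x y; rewrite -(lreprK x) -(lreprK y) lambdaI => /sE /=.
  by rewrite prime_commutator// => /orP[] ?; [left|right]; apply/sE.
Qed.

Lemma ideal_star_Oideal P : prime_ideal P ->
  ideal_star (Oideal P) = Otilde (ideal_star P).
Proof.
move=> [hP _ Pp]; have PE a := le_ideal_star a hP.
congr cjoin; apply/seteqP; split=> [_ [a /OidealP[y ay nPy] <-]|].
  move: ay nPy; rewrite -(lreprK y) => ay nPy; split.
  - exact: asboolW (valP a).
  - apply/PE; have : P (lam a `&` lam (lrepr y)) by rewrite ay; case: hP.
    by move=> /Pp[].
  - by apply/residual_rhoP; exists (lrepr y) => // /PE.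
move=> c [cc _ /(residual_rhoP (kcon cc))[b cb nb]].
by exists (kcon cc) => //; apply/OidealP; exists (lam b) => // /PE.
Qed.

End Reticulation.

Theorem theorem5p7 (sg : signature) (V : variety sg)
    (modV : congruence_modular V) (sdV : semidegenerate V)
    (A : member V) (cA : commutator_closed A) :
  (forall phi : congr A, prime_congr phi ->
     Oideal (con_star sdV cA phi) = con_star sdV cA (Otilde phi)) /\
  (forall P : set (reticulation sdV cA), prime_ideal P ->
     ideal_star (Oideal P) = Otilde (ideal_star P)).
Proof.
split=> [phi hphi|P]; last exact: ideal_star_Oideal.
have hP := con_star_prime sdV cA hphi.
rewrite -[in RHS](con_starK sdV cA hphi) -ideal_star_Oideal// ideal_starK//.
exact: Oideal_ideal.
Qed.
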